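(* Let $d,r\ge2$ and $e\ge1$. There are isomorphisms $$B(d,1,r)\cong B_{r+1,1},$$ $$B(de,e,r)\cong\{\,g\in B_{r+1,1}\mid \operatorname{wd}(g)\equiv 0 \bmod e\,\},$$ $$B(\infty,\infty,r)\cong\{\,g\in B_{r+1,1}\mid \operatorname{wd}(g)=0\,\}.$$ The isomorphism $B(d,1,r)\cong B_{r+1,1}$ is given by $z\mapsto\sigma_1^2$, $t_i\mapsto\sigma_1^{-2i}\sigma_2\sigma_1^{2i}$ for $i\in\mathbb{Z}$, and $s_j\mapsto\sigma_j$ for $3\le j\le r$.
   Context: $B_{r+1}$ is the Artin braid group on $r+1$ strings with standard generators $\sigma_1,\ldots,\sigma_r$. $B_{r+1,1}\subset B_{r+1}$ is the subgroup of 1-pure braids, i.e. braids whose induced permutation fixes $1$; it is generated by $\sigma_1^2,\sigma_2,\ldots,\sigma_r$. The homomorphism $\operatorname{wd}\colon B_{r+1,1}\to\mathbb{Z}$ (winding number of the other strings around the first string) is determined by $\operatorname{wd}(\sigma_1^2)=1$ and $\operatorname{wd}(\sigma_i)=0$ for $2\le i\le r$. For $d,r\ge 2$, $e\ge1$, the braid group $B(de,e,r)$ of the complex reflection group $G(de,e,r)$ is the group with generators $z$, $t_i$ ($i\in\mathbb{Z}$), $s_3,\ldots,s_r$ and relations: $s_is_j=s_js_i$ for $|i-j|\ge2$; $s_is_{i+1}s_i=s_{i+1}s_is_{i+1}$ for $3\le i\le r-1$; $t_it_{i-1}=t_jt_{j-1}$ for $i,j\in\mathbb{Z}$; $s_3t_is_3=t_is_3t_i$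 for $i\in\mathbb{Z}$; $s_jt_i=t_is_j$ for $i\in\mathbb{Z}$, $4\le j\le r$; $zt_i=t_{i-e}z$ for $i\in\mathbb{Z}$; $zs_j=s_jz$ for $3\le j\le r$. $B(d,1,r)$ is the case $e=1$. $B(\infty,\infty,r)$ is the group with generators $t_i$ ($i\in\mathbb{Z}$), $s_3,\ldots,s_r$ and those of these relations not involving $z$. If $r=2$ there are no $s_j$. *)

(* Defs.v *)
From HB Require Import structures.
From mathcomp Require Import all_boot all_order all_algebra perm.
From mathcomp Require Import boolp generic_quotient zify.

Set Implicit Arguments.
Unset Strict Implicit.
Unset Printing Implicit Defensive.

Import Order.TTheory GRing.Theory Num.Theory.
Local Open Scope group_scope.
Local Open Scope quotient_scope.

(* Groups given by generators [A] and relations [R].  All the relations used   *)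
(* below are equalities between positive words, so [R] relates words in the    *)
(* generators; a letter (a, b) of a general word stands for a if b, and for    *)
(* a^-1 otherwise.                                                             *)
Section Presentation.
Variables (A : choiceType) (R : seq A -> seq A -> Prop).

Definition word := seq (A * bool).

Definition posw (s : seq A) : word := [seq (a, true) | a <- s].

Definition winv (w : word) : word := rev [seq (x.1, ~~ x.2) | x <- w].

Inductive pres_eq : word -> word -> Prop :=
| pres_eq_refl w : pres_eq w w
| pres_eq_sym u v : pres_eq u v -> pres_eq v u
| pres_eq_trans v u w : pres_eq u v -> pres_eq v w -> pres_eq u w
| pres_eq_cat u u' v v' :
    pres_eq u u' -> pres_eq v v' -> pres_eq (u ++ v) (u' ++ v')
| pres_eq_cancel a b : pres_eq [:: (a, b); (a, ~~ b)] [::]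
| pres_eq_rel u v : R u v -> pres_eq (posw u) (posw v).

Definition pres_eqb : rel word := fun u v => `[< pres_eq u v >].

Fact pres_eqb_refl : reflexive pres_eqb.
Proof. by move=> w; apply/asboolP; exact: pres_eq_refl. Qed.

Fact pres_eqb_sym : symmetric pres_eqb.
Proof. by move=> u v; apply/asboolP/asboolP; exact: pres_eq_sym. Qed.

Fact pres_eqb_trans : transitive pres_eqb.
Proof.
by move=> v u w /asboolP uv /asboolP vw; apply/asboolP/(pres_eq_trans uv vw).
Qed.

Definition pres_equiv := EquivRel pres_eqb pres_eqb_refl pres_eqb_sym pres_eqb_trans.

Definition presented := {eq_quot pres_equiv}.
HB.instance Definition _ := Choice.on presented.
HB.instance Definition _ := EqQuotient.on presented.

Definition pcls (w : word) : presented := \pi_presented w.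

Lemma pclsP u v : pcls u = pcls v <-> pres_eq u v.
Proof.
split; first by move/eqmodP/asboolP.
by move=> uv; apply/eqmodP/asboolP.
Qed.

Lemma repr_pcls w : pres_eq (repr (pcls w)) w.
Proof. by apply/pclsP; rewrite /pcls reprK. Qed.

Lemma pcls_repr (x : presented) : pcls (repr x) = x.
Proof. exact: reprK. Qed.

Definition pmul (x y : presented) : presented := pcls (repr x ++ repr y).
Definition pone : presented := pcls [::].
Definition pinv (x : presented) : presented := pcls (winv (repr x)).

Lemma pmul_cls u v : pmul (pcls u) (pcls v) = pcls (u ++ v).
Proof. by apply/pclsP/pres_eq_cat; exact: repr_pcls. Qed.

Lemma winv_mulr w : pres_eq (w ++ winv w) [::].
Proof.
elim: w => [|[a b] w IH]; first exact: pres_eq_refl.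
have -> : ((a, b) :: w) ++ winv ((a, b) :: w)
    = [:: (a, b)] ++ ((w ++ winv w) ++ [:: (a, ~~ b)]).
  by rewrite /winv /= rev_cons -cats1 -catA.
apply: (@pres_eq_trans ([:: (a, b)] ++ [:: (a, ~~ b)])).
  apply: pres_eq_cat; first exact: pres_eq_refl.
  rewrite -[X in pres_eq _ X]cat0s; apply: (pres_eq_cat IH); exact: pres_eq_refl.
exact: pres_eq_cancel.
Qed.

Lemma winvK : involutive winv.
Proof.
move=> w; rewrite /winv map_rev revK -map_comp map_id_in // => -[a b] _ /=.
by rewrite negbK.
Qed.

Fact pmulA : associative pmul.
Proof.
move=> x y z; rewrite -(pcls_repr x) -(pcls_repr y) -(pcls_repr z).
by rewrite !pmul_cls catA.
Qed.

Fact pmul1 : left_id pone pmul.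
Proof. by move=> x; rewrite -(pcls_repr x) pmul_cls. Qed.

Fact pmulr1 : right_id pone pmul.
Proof. by move=> x; rewrite -(pcls_repr x) pmul_cls cats0. Qed.

Fact pmulrV : right_inverse pone pinv pmul.
Proof.
by move=> x; rewrite -{1}(pcls_repr x) pmul_cls; apply/pclsP/winv_mulr.
Qed.

Fact pmulVr : left_inverse pone pinv pmul.
Proof.
move=> x; rewrite -{2}(pcls_repr x) pmul_cls; apply/pclsP.
by rewrite -{2}(winvK (repr x)); exact: winv_mulr.
Qed.

HB.instance Definition _ := isGroup.Build presented pmulA pmul1 pmulr1 pmulVr pmulrV.

Definition pgen (a : A) : presented := pcls [:: (a, true)].

Lemma pclsM u v : pcls (u ++ v) = pcls u * pcls v.
Proof. by rewrite -pmul_cls. Qed.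

Lemma pgenV a : pcls [:: (a, false)] = (pgen a)^-1.
Proof.
apply: (mulgI (pgen a)); rewrite mulgV -pclsM; apply/pclsP.
exact: pres_eq_cancel.
Qed.

Section Lift.
Variables (H : groupType) (h : A -> H).

Definition weval (w : word) : H :=
  foldr (fun x acc => (if x.2 then h x.1 else (h x.1)^-1) * acc) 1 w.

Definition pres_lift (x : presented) : H := weval (repr x).

Lemma weval_cat u v : weval (u ++ v) = weval u * weval v.
Proof. by elim: u => [|x u IH] /=; rewrite ?mul1g // IH mulgA. Qed.

Hypothesis hR : forall u v, R u v -> weval (posw u) = weval (posw v).

Lemma weval_eq u v : pres_eq u v -> weval u = weval v.
Proof.
elim=> //.
- by move=> ? ? ? _ -> _ ->.
- by move=> ? ? ? ? _ e1 _ e2; rewrite !weval_cat e1 e2.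
- by move=> a [] /=; rewrite mulg1 ?mulgV ?mulVg.
Qed.

Lemma pres_lift_cls w : pres_lift (pcls w) = weval w.
Proof. exact/weval_eq/repr_pcls. Qed.

Lemma pres_liftM : {morph pres_lift : x y / x * y}.
Proof.
move=> x y; rewrite -(pcls_repr x) -(pcls_repr y) -pclsM !pres_lift_cls.
exact: weval_cat.
Qed.

Lemma pres_lift_gen a : pres_lift (pgen a) = h a.
Proof. by rewrite pres_lift_cls /= mulg1. Qed.
End Lift.
End Presentation.

Section IntegerPower.
Variable G : groupType.

Definition expgz (x : G) (k : int) : G :=
  match k with Posz n => x ^+ n | Negz n => x ^- n.+1 end.
End IntegerPower.

Definition artin_gen (n : nat) := {i : nat | 1 <= i < n}%N.

Inductive artin_rel (n : nat) : seq (artin_gen n) -> seq (artin_gen n) -> Prop :=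
| artin_far (i j : artin_gen n) :
    ((val i).+2 <= val j)%N || ((val j).+2 <= val i)%N -> artin_rel [:: i; j] [:: j; i]
| artin_braid (i j : artin_gen n) :
    val j = (val i).+1 -> artin_rel [:: i; j; i] [:: j; i; j].

Definition braid (n : nat) := presented (@artin_rel n).
HB.instance Definition _ n := Group.on (braid n).

(* [sigma n i] is sigma_i for 1 <= i < n, and the junk value 1 otherwise. *)
Definition sigma (n i : nat) : braid n :=
  if insub i is Some a then pgen (@artin_rel n) a else 1.

(* Strings are numbered from 0, so sigma_i exchanges the positions i - 1 and   *)
(* i, and the first string is ord0.  Products of permutations are composed     *)
(* from left to right, so a braid word is read from left to right.             *)
Definition adj_tperm (r : nat) (i : artin_gen r.+1) : 'S_r.+1 :=
  tperm (inord (val i).-1) (inord (val i)).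

Lemma adj_tpermE (r : nat) (i : artin_gen r.+1) (p : 'I_r.+1) :
  adj_tperm i p = (if p == (val i).-1 :> nat then val i
                   else if p == val i :> nat then (val i).-1 else p) :> nat.
Proof.
have /= /andP[i1 ir] := valP i.
have e1 : (inord (val i).-1 : 'I_r.+1) = (val i).-1 :> nat.
  by rewrite inordK //=; lia.
have e2 : (inord (val i) : 'I_r.+1) = val i :> nat by rewrite inordK.
rewrite /adj_tperm; case: tpermP => [->|->|].
- by rewrite e1 eqxx e2.
- by rewrite e2 e1 eqxx; case: eqP => // ?; lia.
- by move=> /eqP; rewrite -val_eqE /= e1 => /negbTE-> /eqP;
    rewrite -val_eqE /= e2 => /negbTE->.
Qed.

Ltac case_if := rewrite /=; repeat match goal with
  | |- context [(?a == ?b)%N] =>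
      lazymatch a with
      | context [if _ then _ else _] => fail
      | _ => case: (@eqP _ a b) => ? /=
      end
  end.

Lemma adj_tpermV (r : nat) (i : artin_gen r.+1) : (adj_tperm i)^-1 = adj_tperm i.
Proof. exact: tpermV. Qed.

Lemma adj_tperm_rel (r : nat) (u v : seq (artin_gen r.+1)) : artin_rel u v ->
  weval (@adj_tperm r) (posw u) = weval (@adj_tperm r) (posw v).
Proof.
case=> i j; have /= /andP[i1 ir] := valP i; have /= /andP[j1 jr] := valP j.
  move=> /= ij; rewrite /= !mulg1; apply/permP => p; apply/val_inj.
  by rewrite /= !permM !adj_tpermE; case_if; lia.
move=> /= ij; rewrite /= !mulg1; apply/permP => p; apply/val_inj.
by rewrite /= !permM !adj_tpermE; case_if; lia.
Qed.

Definition braid_perm (r : nat) : braid r.+1 -> 'S_r.+1 :=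
  pres_lift (@adj_tperm r).

Lemma braid_permM (r : nat) : {morph @braid_perm r : x y / x * y}.
Proof. exact/pres_liftM/adj_tperm_rel. Qed.

Lemma braid_permF (r : nat) : {morph @braid_perm r : x y / x / y}.
Proof.
by move=> x y; apply: (mulIg (braid_perm y)); rewrite divgK -braid_permM divgK.
Qed.

HB.instance Definition _ (r : nat) :=
  isGroupMorphism.Build (braid r.+1) 'S_r.+1 (@braid_perm r) (@braid_permF r).

(* The sum of the signs of the crossings of w which involve the string         *)
(* starting at position p.                                                     *)
Fixpoint crossings (r : nat) (p : 'I_r.+1) (w : word (artin_gen r.+1)) : int :=
  if w is (i, b) :: w' then
    ((if (p == (val i).-1 :> nat) || (p == val i :> nat) then
       (if b then 1 else -1) else 0) + crossings (adj_tperm i p) w')%R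
  else 0%R.

Lemma crossings_cat (r : nat) (p : 'I_r.+1) (u v : word (artin_gen r.+1)) :
  crossings p (u ++ v)
  = (crossings p u + crossings (weval (@adj_tperm r) u p) v)%R.
Proof.
elim: u p => [|[i b] u IH] p /=; first by rewrite add0r perm1.
by rewrite IH addrA adj_tpermV if_same permM.
Qed.

Lemma crossings_eq (r : nat) (u v : word (artin_gen r.+1)) :
  pres_eq (@artin_rel r.+1) u v -> forall p, crossings p u = crossings p v.
Proof.
elim=> {u v} //.
- by move=> u v w _ IH1 _ IH2 p; rewrite IH1.
- move=> u u' v v' uu' IH1 _ IH2 p; rewrite !crossings_cat IH1 IH2.
  by rewrite (weval_eq (@adj_tperm_rel r) uu').
- move=> i b p; have /= /andP[i1 ir] := valP i.
  by rewrite /= !adj_tpermE; case: b; case_if; lia.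
- move=> u v uv p; case: uv => i j;
    have /= /andP[i1 ir] := valP i; have /= /andP[j1 jr] := valP j => /= ij;
    by rewrite !adj_tpermE; case_if; lia.
Qed.

Lemma crossings_parity (r : nat) (p : 'I_r.+1) (w : word (artin_gen r.+1)) :
  exists k : int, crossings p w = ((weval (@adj_tperm r) w p)%:Z - p%:Z + k * 2)%R.
Proof.
elim: w p => [|[i b] w IH] p /=; first by exists 0%R; rewrite perm1; lia.
have /= /andP[i1 ir] := valP i.
rewrite adj_tpermV if_same permM; have [k ->] := IH (adj_tperm i p).
rewrite adj_tpermE; move: (weval (@adj_tperm r) w (adj_tperm i p)) => q.
case: b; case_if; by [exists k; lia | exists (k + 1)%R; lia | exists (k - 1)%R; lia].
Qed.

Definition pure1_pred (r : nat) : {pred braid r.+1} :=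
  fun g => braid_perm g ord0 == ord0.

Fact pure1_closed (r : nat) : group_closed (@pure1_pred r).
Proof.
split; first by rewrite unfold_in gmulf1 perm1.
move=> g h; rewrite !unfold_in => /eqP g0 /eqP h0.
by rewrite gmulfF permM g0 -{1}h0 permK.
Qed.

Lemma braid_perm_gen (r : nat) (i : artin_gen r.+1) :
  braid_perm (pgen (@artin_rel r.+1) i) = adj_tperm i.
Proof. exact/pres_lift_gen/adj_tperm_rel. Qed.

Lemma sigma1_pure1 (r : nat) : (1 <= r)%N -> sigma r.+1 1 ^+ 2 \in @pure1_pred r.
Proof.
move=> r1; rewrite unfold_in /sigma; case: insubP => [i _ i1|]; last by rewrite /=; lia.
rewrite expgS expg1 braid_permM braid_perm_gen.
by rewrite permM -val_eqE /= !adj_tpermE i1.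
Qed.

Lemma sigma_pure1 (r i : nat) : (2 <= i <= r)%N -> sigma r.+1 i \in @pure1_pred r.
Proof.
move=> ir; rewrite unfold_in /sigma; case: insubP => [j _ ji|]; last by rewrite /=; lia.
rewrite braid_perm_gen -val_eqE /= adj_tpermE ji.
by case_if; lia.
Qed.

Definition pure1 (r : nat) := {g : braid r.+1 | pure1_pred g}.
HB.instance Definition _ (r : nat) := SubChoice.on (pure1 r).
HB.instance Definition _ (r : nat) :=
  SubChoice_isSubGroup.Build (braid r.+1) (@pure1_pred r) (pure1 r) (@pure1_closed r).

(* The winding number of the other strings around the first one: half the sum  *)
(* of the signs of the crossings involving the first string.  That sum is even *)
(* for a 1-pure braid, so the integer division below is exact.                 *)
Definition wd (r : nat) (g : pure1 r) : int :=
  (crossings ord0 (repr (val g)) %/ 2)%Z.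

Lemma wd_crossings (r : nat) (g : pure1 r) (w : word (artin_gen r.+1)) :
  val g = pcls (@artin_rel r.+1) w -> crossings ord0 w = (wd g * 2)%R.
Proof.
move=> gw; rewrite /wd.
have rw : pres_eq (@artin_rel r.+1) (repr (val g)) w by rewrite gw; exact: repr_pcls.
rewrite -(crossings_eq rw).
have [k ->] := crossings_parity ord0 (repr (val g)).
have -> : weval (@adj_tperm r) (repr (val g)) ord0 = ord0 by exact/eqP/(valP g).
by lia.
Qed.

Lemma wdM (r : nat) (g h : pure1 r) : wd (g * h) = (wd g + wd h)%R.
Proof.
have gw := esym (pcls_repr (val g)); have hw := esym (pcls_repr (val h)).
have ghw : val (g * h) = pcls (@artin_rel r.+1) (repr (val g) ++ repr (val h)).
  by rewrite valM {1}gw {1}hw -pclsM.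
have := wd_crossings ghw; rewrite crossings_cat.
have -> : weval (@adj_tperm r) (repr (val g)) ord0 = ord0 by exact/eqP/(valP g).
rewrite (wd_crossings gw) (wd_crossings hw); lia.
Qed.

Lemma wd1 (r : nat) : wd (1 : pure1 r) = 0%R.
Proof. by have := wdM (1 : pure1 r) 1; rewrite mulg1; lia. Qed.

Lemma wdF (r : nat) (g h : pure1 r) : wd (g / h) = (wd g - wd h)%R.
Proof. by have := wdM (g / h) h; rewrite divgK; lia. Qed.

Lemma wd_sigma1 (r : nat) (g : pure1 r) :
  (1 <= r)%N -> val g = sigma r.+1 1 ^+ 2 -> wd g = 1%R.
Proof.
move=> r1; rewrite /sigma; case: insubP => [i _ i1|]; last by rewrite /=; lia.
rewrite expgS expg1 -pclsM => /wd_crossings /=.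
by rewrite !adj_tpermE /= i1 /=; lia.
Qed.

Lemma wd_sigma (r i : nat) (g : pure1 r) :
  (2 <= i <= r)%N -> val g = sigma r.+1 i -> wd g = 0%R.
Proof.
move=> ir; rewrite /sigma; case: insubP => [j _ ji|]; last by rewrite /=; lia.
by move=> /wd_crossings; rewrite /= ji; case_if; lia.
Qed.

Definition wd_mod_pred (e r : nat) : {pred pure1 r} :=
  fun g => (wd g == 0 %[mod e])%Z.

Fact wd_mod_closed (e r : nat) : group_closed (@wd_mod_pred e r).
Proof.
split; first by rewrite unfold_in wd1.
move=> g h; rewrite !unfold_in wdF => /eqP ge /eqP he.
by rewrite -modzDm ge -modzNm he modzNm modzDm.
Qed.

Definition pure1_wd_mod (e r : nat) := {g : pure1 r | wd_mod_pred e g}.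
HB.instance Definition _ (e r : nat) := SubChoice.on (pure1_wd_mod e r).
HB.instance Definition _ (e r : nat) :=
  SubChoice_isSubGroup.Build (pure1 r) (@wd_mod_pred e r) (pure1_wd_mod e r)
    (@wd_mod_closed e r).

Definition wd_zero_pred (r : nat) : {pred pure1 r} := fun g => wd g == 0%R.

Fact wd_zero_closed (r : nat) : group_closed (@wd_zero_pred r).
Proof.
split; first by rewrite unfold_in wd1.
by move=> g h; rewrite !unfold_in wdF => /eqP -> /eqP ->.
Qed.

Definition pure1_wd_zero (r : nat) := {g : pure1 r | wd_zero_pred g}.
HB.instance Definition _ (r : nat) := SubChoice.on (pure1_wd_zero r).
HB.instance Definition _ (r : nat) :=
  SubChoice_isSubGroup.Build (pure1 r) (@wd_zero_pred r) (pure1_wd_zero r)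
    (@wd_zero_closed r).

Definition s_index (r : nat) := {j : nat | 3 <= j <= r}%N.

(* The relations which do not involve z, for generators t_i and s_j embedded   *)
(* in a possibly larger set of generators.                                     *)
Section RelationsTS.
Variables (A : Type) (r : nat) (t : int -> A) (s : s_index r -> A).

Inductive ts_rel : seq A -> seq A -> Prop :=
| ts_rel_ss (i j : s_index r) :
    ((val i).+2 <= val j)%N || ((val j).+2 <= val i)%N ->
    ts_rel [:: s i; s j] [:: s j; s i]
| ts_rel_sss (i j : s_index r) : val j = (val i).+1 ->
    ts_rel [:: s i; s j; s i] [:: s j; s i; s j]
| ts_rel_tt (i j : int) :
    ts_rel [:: t i; t (i - 1)%R] [:: t j; t (j - 1)%R]
| ts_rel_sts (j : s_index r) (i : int) : val j = 3 ->
    ts_rel [:: s j; t i; s j] [:: t i; s j; t i]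
| ts_rel_st (j : s_index r) (i : int) : (4 <= val j)%N ->
    ts_rel [:: s j; t i] [:: t i; s j].
End RelationsTS.

Inductive cr_gen (r : nat) := CRz | CRt of int | CRs of s_index r.
Arguments CRz {r}.
Arguments CRt {r}.
HB.instance Definition _ (r : nat) := gen_eqMixin (cr_gen r).
HB.instance Definition _ (r : nat) := gen_choiceMixin (cr_gen r).

Inductive cr_rel (e r : nat) : seq (cr_gen r) -> seq (cr_gen r) -> Prop :=
| cr_rel_ts u v : ts_rel CRt (@CRs r) u v -> cr_rel e u v
| cr_rel_zt (i : int) : cr_rel e [:: CRz; CRt i] [:: CRt (i - e%:Z)%R; CRz]
| cr_rel_zs (j : s_index r) : cr_rel e [:: CRz; CRs j] [:: CRs j; CRz].

(* The braid group B(de, e, r) for d >= 2; its presentation does not depend on *)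
(* the first parameter.                                                        *)
Definition cr_braid (de e r : nat) := presented (@cr_rel e r).
HB.instance Definition _ (de e r : nat) := Group.on (cr_braid de e r).

Definition cr_z (de e r : nat) : cr_braid de e r := pgen (@cr_rel e r) CRz.

Definition cr_t (de e r : nat) (i : int) : cr_braid de e r :=
  pgen (@cr_rel e r) (CRt i).

Definition cr_s (de e r : nat) (j : s_index r) : cr_braid de e r :=
  pgen (@cr_rel e r) (CRs j).

(* The group B(oo, oo, r). *)
Inductive cr_inf_gen (r : nat) := CRIt of int | CRIs of s_index r.
Arguments CRIt {r}.
HB.instance Definition _ (r : nat) := gen_eqMixin (cr_inf_gen r).
HB.instance Definition _ (r : nat) := gen_choiceMixin (cr_inf_gen r).

Definition cr_inf_braid (r : nat) := presented (ts_rel CRIt (@CRIs r)).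
HB.instance Definition _ (r : nat) := Group.on (cr_inf_braid r).

(* Main.v *)
From HB Require Import structures.
Require Import Defs.
From mathcomp Require Import all_boot all_order all_algebra perm.
From mathcomp Require Import zify.

(* Everything rests on Schreier cocycles.  A group presented by R which acts  *)
(* on a set X, with a G-valued cocycle on the generators respecting R, gets a *)
(* cocycle c with c(gh, x) = c(g, x) c(h, g.x), and c(-, x0) is a morphism to *)
(* G on the stabilizer of x0.                                                 *)
(*   For B_{r+1} acting on the positions of the strings, the representatives  *)
(* T_p = sigma_1 ... sigma_p of the cosets of B_{r+1,1} satisfy               *)
(* T_p g = f(c(g, p)) T_(g.p), where f : B(d,1,r) -> B_{r+1,1} is the map of  *)
(* the theorem, and c(f(x), 0) = x; so c(-, 0) is the inverse of f.           *)
(*   For B(d,1,r) acting on the integers, z by translation by 1 and the other *)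
(* generators trivially, x acts as translation by wd(f(x)), and the coset     *)
(* representatives z^k give x = F(c(x, 0)) z^wd(f(x)).  Here F, defined on    *)
(* B(oo,oo,r) or B(de,e,r), fixes the t_i and s_j and sends z to z^e.         *)

Set Implicit Arguments.
Unset Strict Implicit.
Unset Printing Implicit Defensive.

Import Order.TTheory GRing.Theory Num.Theory.
Local Open Scope group_scope.

(** This is the Reidemeister-Schreier method, with the rewriting done by a cocycle. B(d,1,r) is the
    Artin group of type B on z, t_0, s_3, ..., s_r: t_0 t_(-1) = t_(-1) t_(-2) amounts to the
    four-term relation of z and t_0 ([cr_type_B]), and conversely a type B system satisfies all the
    relations once t_i is t_0 conjugated by z^i ([type_B_map_rel]). As sigma_1^2, sigma_2, ...,
    sigma_r is such a system ([pure_gen_rel]), f exists. The cocycle on string positions respects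
    the braid relations thanks to relations derived in type B ([band_near], [band_four]). The coset
    formula [coset_rep_coc] at p = 0 makes f surjective, and [cr_to_pure1K] makes it injective.

    For the other two groups, the cocycle on the integers recovers an element of B(oo,oo,r) from its
    image in B(d,1,r) ([cr_inf_incl_coc]), and one of B(de,e,r) up to a power of z ([cr_incl_coc]),
    whence injectivity. Surjectivity comes from [z_coc_decomp], where by [z_act_wd] the factor
    z^wd(f(x)) is trivial or a power of z^e. *)

(** * Morphisms, conjugation and integer powers in groups *)

Section Morphisms.
Variables (G H : groupType) (f : G -> H).
Hypothesis fM : {morph f : x y / x * y}.

Lemma morph_mul1 : f 1 = 1.
Proof. by apply: (mulgI (f 1)); rewrite -fM !mulg1. Qed.

Lemma morph_mulV : {morph f : x / x^-1}.
Proof. by move=> x; apply: (mulgI (f x)); rewrite -fM !mulgV morph_mul1. Qed.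

Lemma morph_conjg : {morph f : x y / x ^ y}.
Proof. by move=> x y; rewrite !conjgE !fM morph_mulV. Qed.

End Morphisms.

Section GroupLemmas.
Variable G : groupType.
Implicit Types x y : G.

Lemma commuteJ x y z : commute x y -> commute (x ^ z) (y ^ z).
Proof. by move=> xy; rewrite /commute -!conjMg xy. Qed.

Lemma conjg_commute x y : commute x y -> x ^ y = x.
Proof. by move=> xy; rewrite conjgE xy mulKg. Qed.

Lemma commute_conj x y z : commute x y -> commute x z -> commute x (y ^ z).
Proof. by move=> xy xz; rewrite -(conjg_commute xz); apply: commuteJ. Qed.

Lemma expgzS x (k : int) : expgz x (k + 1)%R = expgz x k * x.
Proof.
case: k => [n|[|n]].
- have -> : (Posz n + 1)%R = Posz n.+1 by lia.
  by rewrite /= expgSr.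
- by rewrite /= mulVg.
- have -> : (Negz n.+1 + 1)%R = Negz n by lia.
  by rewrite /= [x ^+ n.+2]expgS invgM mulgVK.
Qed.

Lemma expgzB1 x (k : int) : expgz x (k - 1)%R = expgz x k * x^-1.
Proof. by apply: (mulIg x); rewrite -expgzS mulgVK; congr expgz; lia. Qed.

Lemma int_ind_step (P : int -> Prop) :
  P 0%R -> (forall k, P k -> P (k + 1)%R) -> (forall k, P k -> P (k - 1)%R) ->
  forall k, P k.
Proof.
move=> P0 PS PP; case=> n.
  elim: n => // n /PS.
  by have -> : (Posz n + 1)%R = Posz n.+1 by lia.
elim: n => [|n /PP]; first exact: (PP 0%R).
by have -> : (Negz n - 1)%R = Negz n.+1 by lia.
Qed.

Lemma expgzD x (k l : int) : expgz x (k + l)%R = expgz x k * expgz x l.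
Proof.
elim/int_ind_step: l => [|l IH|l IH]; first by rewrite addr0 mulg1.
  by rewrite addrA !expgzS IH mulgA.
by rewrite addrA !expgzB1 IH mulgA.
Qed.

Lemma expgzN x (k : int) : expgz x (- k)%R = (expgz x k)^-1.
Proof. by apply: (mulIg (expgz x k)); rewrite -expgzD mulVg addNr. Qed.

Lemma expgz_closed (P : G -> Prop) x :
  P 1 -> (forall u v, P u -> P v -> P (u * v)) -> (forall u, P u -> P u^-1) ->
  P x -> forall k : int, P (expgz x k).
Proof.
move=> P1 PM PV Px k; elim/int_ind_step: k => // k Pk.
  by rewrite expgzS; apply: PM.
by rewrite expgzB1; apply/PM/PV.
Qed.

Lemma expgz_expg x (n : nat) (k : int) :
  expgz x (n%:Z * k)%R = expgz (x ^+ n) k.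
Proof.
elim/int_ind_step: k => [|k IH|k IH]; first by rewrite mulr0.
  by rewrite expgzS -IH mulrDr mulr1 expgzD.
by rewrite expgzB1 -IH mulrBr mulr1 expgzD expgzN.
Qed.

Lemma expgz_commute x y (k : int) : commute y x -> commute y (expgz x k).
Proof.
move=> yx; apply: (expgz_closed (P := fun u => commute y u)) => //.
- exact: commute1.
- by move=> u v; apply: commuteM.
- by move=> u; apply: commuteV.
Qed.

End GroupLemmas.

Lemma morph_expgz (G H : groupType) (f : G -> H) : {morph f : x y / x * y} ->
  forall x (k : int), f (expgz x k) = expgz (f x) k.
Proof.
move=> fM x k; elim/int_ind_step: k => [|k IH|k IH]; first exact: morph_mul1.
  by rewrite !expgzS fM IH.
by rewrite !expgzB1 fM IH morph_mulV.
Qed.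

(** * Cocycles on presented groups *)

Section PresentedGroups.
Variables (A : choiceType) (R : seq A -> seq A -> Prop).

Lemma presented_ind (P : presented R -> Prop) :
  P 1 -> (forall x y, P x -> P y -> P (x * y)) -> (forall x, P x -> P x^-1) ->
  (forall a, P (pgen R a)) -> forall x, P x.
Proof.
move=> P1 PM PV Pg x; rewrite -(pcls_repr x).
elim: (repr x) => [|[a b] w IH]; first exact: P1.
rewrite -cat1s pclsM; apply: PM => //.
by case: b; [exact: Pg | rewrite pgenV; apply/PV/Pg].
Qed.

Lemma pgen_rel u v : R u v ->
  foldr (fun a x => pgen R a * x) 1 u = foldr (fun a x => pgen R a * x) 1 v.
Proof.
have pE w : foldr (fun a x => pgen R a * x) 1 w = pcls R (posw w).
  by elim: w => //= a w ->; rewrite -pclsM.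
by move=> uv; rewrite !pE; apply/pclsP/pres_eq_rel.
Qed.

Section Cocycle.
Variables (G : groupType) (X : Type).
Variables (mv mvV : A -> X -> X) (c : A -> X -> G).
Hypothesis mvK : forall a, cancel (mv a) (mvV a).
Hypothesis mvVK : forall a, cancel (mvV a) (mv a).

Fixpoint word_act (w : word A) (x : X) : X :=
  if w is (a, b) :: w' then word_act w' (if b then mv a x else mvV a x) else x.

(** The value at an inverse letter is forced by c(a^-1 a, x) = 1. *)
Fixpoint word_coc (w : word A) (x : X) : G :=
  if w is (a, b) :: w' then
    (if b then c a x else (c a (mvV a x))^-1)
    * word_coc w' (if b then mv a x else mvV a x)
  else 1.

Lemma word_act_cat u v x : word_act (u ++ v) x = word_act v (word_act u x).
Proof. by elim: u x => [|[a b] u IH] x //=; rewrite IH. Qed.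

Lemma word_coc_cat u v x :
  word_coc (u ++ v) x = word_coc u x * word_coc v (word_act u x).
Proof. by elim: u x => [|[a b] u IH] x /=; rewrite ?mul1g // IH mulgA. Qed.

Hypothesis act_rel : forall u v x, R u v ->
  word_act (posw u) x = word_act (posw v) x.
Hypothesis coc_rel : forall u v x, R u v ->
  word_coc (posw u) x = word_coc (posw v) x.

Lemma word_act_eq u v : pres_eq R u v -> word_act u =1 word_act v.
Proof.
elim=> {u v} //.
- by move=> u v _ IH x; rewrite IH.
- by move=> u v w _ IH1 _ IH2 x; rewrite IH1.
- by move=> u u' v v' _ IH1 _ IH2 x; rewrite !word_act_cat IH1 IH2.
- by move=> a [] x /=; rewrite ?mvK ?mvVK.
- by move=> u v uv x; apply: act_rel.
Qed.

Lemma word_coc_eq u v : pres_eq R u v -> word_coc u =1 word_coc v.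
Proof.
elim=> {u v} //.
- by move=> u v _ IH x; rewrite IH.
- by move=> u v w _ IH1 _ IH2 x; rewrite IH1.
- move=> u u' v v' uu' IH1 _ IH2 x.
  by rewrite !word_coc_cat IH1 IH2 (word_act_eq uu').
- by move=> a [] x /=; rewrite ?mvK mulg1 ?mulgV ?mulVg.
- by move=> u v uv x; apply: coc_rel.
Qed.

Definition pres_act (g : presented R) : X -> X := word_act (repr g).
Definition pres_coc (g : presented R) : X -> G := word_coc (repr g).

Lemma pres_act_cls w : pres_act (pcls R w) =1 word_act w.
Proof. exact/word_act_eq/repr_pcls. Qed.

Lemma pres_coc_cls w : pres_coc (pcls R w) =1 word_coc w.
Proof. exact/word_coc_eq/repr_pcls. Qed.

Lemma pres_act1 x : pres_act 1 x = x.
Proof. exact: (pres_act_cls [::]). Qed.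

Lemma pres_coc1 x : pres_coc 1 x = 1.
Proof. exact: (pres_coc_cls [::]). Qed.

Lemma pres_actM g h x : pres_act (g * h) x = pres_act h (pres_act g x).
Proof.
rewrite -(pcls_repr g) -(pcls_repr h) -pclsM !pres_act_cls.
exact: word_act_cat.
Qed.

Lemma pres_cocM g h x :
  pres_coc (g * h) x = pres_coc g x * pres_coc h (pres_act g x).
Proof.
rewrite -(pcls_repr g) -(pcls_repr h) -pclsM !pres_coc_cls pres_act_cls.
exact: word_coc_cat.
Qed.

Lemma pres_actK g : cancel (pres_act g) (pres_act g^-1).
Proof. by move=> x; rewrite -pres_actM mulgV pres_act1. Qed.

Lemma pres_actVK g : cancel (pres_act g^-1) (pres_act g).
Proof. by move=> x; rewrite -pres_actM mulVg pres_act1. Qed.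

Lemma pres_cocV g x : pres_coc g^-1 (pres_act g x) = (pres_coc g x)^-1.
Proof.
by apply: (mulgI (pres_coc g x)); rewrite -pres_cocM !mulgV pres_coc1.
Qed.

Lemma pres_act_gen a x : pres_act (pgen R a) x = mv a x.
Proof. by rewrite pres_act_cls. Qed.

Lemma pres_coc_gen a x : pres_coc (pgen R a) x = c a x.
Proof. by rewrite pres_coc_cls /= mulg1. Qed.

End Cocycle.
End PresentedGroups.

(** * The Schreier cocycle of the braid group, with values in a type B system *)

Ltac decide_ifs := repeat match goal with
  | |- context [if ?b then _ else _] =>
      lazymatch b with
      | context [if _ then _ else _] => fail
      | _ => first [rewrite (_ : b = true); last lia
                   |rewrite (_ : b = false); last lia]
      end
  end.

(* If a_1, ..., a_r are the generators of type B of B(d,1,r) (so a_1 = z and  *)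
(* a_2 = t_0), then band a p stands for T_p sigma_p T_(p-1)^-1, for p >= 1.   *)
Fixpoint band (G : groupType) (a : nat -> G) (p : nat) : G :=
  match p with
  | 0 => 1
  | q.+1 => if q is 0 then a 1%N else band a q ^ a q.+1
  end.

Lemma bandS (G : groupType) (a : nat -> G) p :
  1 <= p -> band a p.+1 = band a p ^ a p.+1.
Proof. by case: p. Qed.

Lemma morph_band (G H : groupType) (f : G -> H) (a : nat -> G) (b : nat -> H)
    n :
  {morph f : x y / x * y} -> (forall i, 1 <= i <= n -> f (a i) = b i) ->
  forall p, 1 <= p <= n -> f (band a p) = band b p.
Proof.
move=> fM fa; elim=> [|p IH] // pn; case: (posnP p) => [p0|p_gt0].
  by rewrite p0 /= fa //; lia.
by rewrite !bandS // (morph_conjg fM) IH ?fa //; lia.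
Qed.

Section TypeB.
Variables (G : groupType) (r : nat) (a : nat -> G).

(** The Artin relations of type B_r, with the four-term relation between [a 1] and [a 2]. *)
Definition type_B_rel : Prop :=
  [/\ forall i j, 1 <= i -> i.+2 <= j <= r -> commute (a i) (a j),
      forall i, 2 <= i < r -> a i * a i.+1 * a i = a i.+1 * a i * a i.+1
    & 2 <= r -> a 1%N * a 2 * a 1%N * a 2 = a 2 * a 1%N * a 2 * a 1%N].

Hypothesis aB : type_B_rel.

Let a_far i j : 1 <= i -> i.+2 <= j <= r -> commute (a i) (a j).
Proof. by case: aB => h _ _; apply: h. Qed.
Let a_braid i : 2 <= i < r -> a i * a i.+1 * a i = a i.+1 * a i * a i.+1.
Proof. by case: aB => _ h _; apply: h. Qed.

Lemma band_far p j : 1 <= p -> p.+2 <= j <= r -> commute (a j) (band a p).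
Proof.
elim: p => [|p IH] // _ pj; case: (posnP p) => [p0|p_gt0].
  by rewrite p0; apply/commute_sym/a_far; lia.
rewrite bandS //; apply: commute_conj; first by apply: IH; lia.
by apply/commute_sym/a_far; lia.
Qed.

Lemma a_braidJ i : 2 <= i < r -> a i.+1 ^ (a i * a i.+1) = a i.
Proof.
move=> ir; rewrite conjgE; apply: (mulgI (a i * a i.+1)).
by rewrite mulVKg mulgA -a_braid // mulgA.
Qed.

(** If p = j + 1, conjugation by [a j * a j.+1] takes [band a j.-1] to [band a p] and [a j.+1] to
    [a j], and the sources commute by [band_far]. For larger p, [a p] commutes with [a j] and
    induction applies. *)
Lemma band_near p j : 2 <= j < p -> p <= r -> commute (a j) (band a p).
Proof.
elim: p => [|p IH] jp pr; first lia.
rewrite bandS; last lia.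
case: (ltnP j p) => [jp'|pj].
  apply: commute_conj; first by apply: IH; lia.
  by apply: a_far; lia.
have -> : j = p by lia.
case: p IH jp pr pj => [|p] IH jp pr pj; first lia.
rewrite bandS -?conjgM; last lia.
rewrite -[X in commute X _](a_braidJ (i := p.+1)); last lia.
by apply/commuteJ/band_far; lia.
Qed.

(** Conjugation by [a p.+2 * a p.+1] carries the pair [band a p], [a p.+1] to the next pair
    [band a p.+1], [a p.+2]; the case p = 1 is a relation of type B. *)
Lemma band_four p : 1 <= p < r ->
  band a p * a p.+1 * band a p * a p.+1 = a p.+1 * band a p * a p.+1 * band a p.
Proof.
elim: p => [|p IH] // pr; case: (posnP p) => [p0|p_gt0].
  by rewrite p0 /=; case: aB => _ _ -> //; lia.
have [g e1 e2] : exists2 g,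
    band a p.+1 = band a p ^ g & a p.+2 = a p.+1 ^ g.
  exists (a p.+2 * a p.+1).
    rewrite conjgM bandS // [X in _ = X ^ _]conjg_commute //.
    by apply/commute_sym/band_far; lia.
  rewrite conjgE; apply: (mulgI (a p.+2 * a p.+1)).
  by rewrite mulVKg mulgA -a_braid ?mulgA //; lia.
by rewrite e1 e2 -!conjMg IH //; lia.
Qed.

(* The element T_p sigma_i T_(sigma_i.p)^-1 of B_{r+1,1}, written in the      *)
(* generators of type B.                                                      *)
Definition schreier (i p : nat) : G :=
  if p == i.-1 then 1 else if p == i then band a i
  else if (p < i)%N then a i else a i.+1.

Definition braid_coc (i : artin_gen r.+1) (p : 'I_r.+1) : G :=
  schreier (val i) p.

Lemma word_act_perm (w : word (artin_gen r.+1)) (p : 'I_r.+1) :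
  word_act (@adj_tperm r) (@adj_tperm r) w p = weval (@adj_tperm r) w p.
Proof.
elim: w p => [|[i b] w IH] p /=; first by rewrite perm1.
by rewrite adj_tpermV !if_same IH permM.
Qed.

Lemma braid_act_rel (u v : seq (artin_gen r.+1)) (p : 'I_r.+1) :
  artin_rel u v ->
  word_act (@adj_tperm r) (@adj_tperm r) (posw u) p
  = word_act (@adj_tperm r) (@adj_tperm r) (posw v) p.
Proof. by move=> uv; rewrite !word_act_perm (adj_tperm_rel uv). Qed.

(** Only p = i and p = j meet a band element; there [band_far] and [band_near] apply. *)
Lemma schreier_far i j p : (1 <= i)%N -> (i.+2 <= j <= r)%N -> (p <= r)%N ->
  let sw j q := if q == j.-1 then j else if q == j then j.-1 else q in
  schreier i p * schreier j (sw i p) = schreier j p * schreier i (sw j p).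
Proof.
move=> i1 ij pr /=.
have [h|h] := ltnP p i.-1.
  by rewrite /schreier; decide_ifs; apply: a_far; lia.
have [h1|h1] := eqVneq p i.-1.
  by rewrite /schreier; decide_ifs; rewrite mul1g mulg1.
have [h2|h2] := eqVneq p i.
  by rewrite /schreier; decide_ifs; apply/commute_sym/band_far; lia.
have [h3|h3] := ltnP p j.-1.
  by rewrite /schreier; decide_ifs; apply: a_far; lia.
have [h4|h4] := eqVneq p j.-1.
  by rewrite /schreier; decide_ifs; rewrite mul1g mulg1.
have [h5|h5] := eqVneq p j.
  by rewrite /schreier; decide_ifs; apply: band_near; lia.
by rewrite /schreier; decide_ifs; apply: a_far; lia.
Qed.

(** At p = i this is the recursion defining [band], at p = i + 1 it is [band_four]. At p = i - 1
    both sides are [a i.+1], and elsewhere it is a braid relation. *)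
Lemma schreier_braid i p : (1 <= i < r)%N -> (p <= r)%N ->
  let sw j q := if q == j.-1 then j else if q == j then j.-1 else q in
  schreier i p * (schreier i.+1 (sw i p) * schreier i (sw i.+1 (sw i p)))
  = schreier i.+1 p
    * (schreier i (sw i.+1 p) * schreier i.+1 (sw i (sw i.+1 p))).
Proof.
move=> ir pr /=.
have [h|h] := ltnP p i.-1.
  by rewrite /schreier; decide_ifs; rewrite !mulgA; apply: a_braid; lia.
have [h1|h1] := eqVneq p i.-1.
  by rewrite /schreier; decide_ifs; rewrite !mul1g !mulg1.
have [h2|h2] := eqVneq p i.
  rewrite /schreier; decide_ifs; rewrite !mul1g !mulg1 bandS; last lia.
  by rewrite -conjgC.
have [h3|h3] := eqVneq p i.+1.
  rewrite /schreier; decide_ifs; rewrite bandS; last lia.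
  rewrite mulgA -conjgC conjgE; apply: (mulgI (a i.+1)).
  rewrite [RHS]mulgA mulVKg !mulgA.
  by have := band_four (p := i); rewrite -!mulgA => <-; rewrite ?mulgA //; lia.
by rewrite /schreier; decide_ifs; rewrite !mulgA; apply: a_braid; lia.
Qed.

Lemma braid_coc_rel (u v : seq (artin_gen r.+1)) (p : 'I_r.+1) :
  artin_rel u v ->
  word_coc (@adj_tperm r) (@adj_tperm r) braid_coc (posw u) p
  = word_coc (@adj_tperm r) (@adj_tperm r) braid_coc (posw v) p.
Proof.
have pr : (p <= r)%N by rewrite -ltnS.
case=> i j; have /= /andP[i1 ir] := valP i;
  have /= /andP[j1 jr] := valP j => /= ij.
  rewrite /= !mulg1 /braid_coc !adj_tpermE.
  case/orP: ij => /= ij; first by apply: schreier_far; lia.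
  by symmetry; apply: schreier_far; lia.
rewrite /= !mulg1 /braid_coc !adj_tpermE /= ij.
by apply: schreier_braid; lia.
Qed.

End TypeB.

(** * Coset representatives in the braid group *)

Section BraidRelations.
Variable n : nat.

Lemma sigma_gen (i : artin_gen n) : sigma n (val i) = pgen (@artin_rel n) i.
Proof. by rewrite /sigma valK. Qed.

Lemma sigma_far i j : (i.+2 <= j)%N -> commute (sigma n i) (sigma n j).
Proof.
move=> ij; rewrite /sigma; case: insubP => [u _ ui|_]; last first.
  exact/commute_sym/commute1.
case: insubP => [v _ vj|_]; last exact: commute1.
have := @pgen_rel _ (@artin_rel n) [:: u; v] [:: v; u].
rewrite /= !mulg1; apply; apply: artin_far.
by rewrite [val u]ui [val v]vj ij.
Qed.

Lemma sigma_braid i : (1 <= i)%N -> (i.+1 < n)%N ->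
  sigma n i * sigma n i.+1 * sigma n i
  = sigma n i.+1 * sigma n i * sigma n i.+1.
Proof.
move=> i1 ir; rewrite /sigma; case: insubP => [u _ ui|]; last lia.
case: insubP => [v _ vj|]; last lia.
have := @pgen_rel _ (@artin_rel n) [:: u; v; u] [:: v; u; v].
by rewrite /= !mulg1 !mulgA; apply; apply: artin_braid; rewrite ui vj.
Qed.

Fixpoint coset_rep (p : nat) : braid n :=
  if p is q.+1 then coset_rep q * sigma n q.+1 else 1.

Lemma coset_rep_far p i : (p.+2 <= i)%N ->
  coset_rep p * sigma n i = sigma n i * coset_rep p.
Proof.
move=> pi; apply/commute_sym; elim: p pi => [|p IH] pi; first exact: commute1.
apply: commuteM; first by apply: IH; lia.
by apply/commute_sym/sigma_far; lia.
Qed.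

(** Moving left, sigma_i commutes with the factors of index above i + 1, becomes sigma_(i+1) by the
    braid relation with sigma_i sigma_(i+1), and then commutes with the rest. *)
Lemma coset_rep_near p i : (1 <= i < p)%N -> (p < n)%N ->
  coset_rep p * sigma n i = sigma n i.+1 * coset_rep p.
Proof.
elim: p => [|p IH] ip pn; first lia.
have [ip'|pi] := ltnP i p.
  rewrite /= -mulgA (_ : _ * sigma n i = sigma n i * sigma n p.+1).
    by rewrite mulgA IH ?mulgA //; lia.
  by apply/commute_sym/sigma_far; lia.
have -> : i = p by lia.
case: p IH ip pn pi => [|p] IH ip pn _; first lia.
rewrite /= -!mulgA [sigma n p.+1 * _]mulgA sigma_braid //.
rewrite -mulgA mulgA coset_rep_far ?mulgA //.
Qed.

Definition pure_sigma (j : nat) : braid n :=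
  if j == 1%N then sigma n 1 ^+ 2 else sigma n j.

Lemma coset_rep_band p : (1 <= p < n)%N ->
  coset_rep p * sigma n p = band pure_sigma p * coset_rep p.-1.
Proof.
elim: p => // p IH pn; case: (posnP p) => [->|p_gt0].
  by rewrite /= mul1g mulg1 /pure_sigma /= expg2.
rewrite bandS // conjgE /=.
have -> : pure_sigma p.+1 = sigma n p.+1.
  by rewrite /pure_sigma; case: p p_gt0 {IH pn}.
rewrite -[RHS]mulgA; apply: (mulgI (sigma n p.+1)); rewrite [RHS]mulVKg.
case: p p_gt0 IH pn => // p _ IH pn.
have far :
    sigma n p.+2 * coset_rep p.+1 = coset_rep p * (sigma n p.+2 * sigma n p.+1).
  by rewrite /= !mulgA coset_rep_far.
have {}IH :
    band pure_sigma p.+1 * coset_rep p = coset_rep p.+1 * sigma n p.+1.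
  by rewrite IH //; lia.
(* Both sides become T_(p+2) sigma_(p+1) sigma_(p+2): the right one by a braid relation, the left
   one by [coset_rep_near]. *)
rewrite -[RHS]mulgA far [RHS]mulgA IH.
rewrite -[RHS]mulgA [X in _ = _ * X]mulgA sigma_braid //; try lia.
rewrite (_ : coset_rep p.+1 * sigma n p.+2 = coset_rep p.+2) //.
rewrite mulgA -coset_rep_near //; last lia.
by rewrite /= -!mulgA.
Qed.

End BraidRelations.

(** * From type B systems to the relations of B(d,1,r) *)

(** The product is b y b y^-1 conjugated by y^i, and the four-term relation makes b y b y^-1 commute
    with y. Hence t_i t_(i-1) does not depend on i. *)
Lemma conj_expgz_prod (G : groupType) (y b : G) (i : int) :
  y * b * y * b = b * y * b * y ->
  b ^ expgz y i * b ^ expgz y (i - 1)%R = b * y * b * y^-1.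
Proof.
move=> yb; have -> : (i - 1 = - 1 + i)%R by lia.
rewrite (expgzD y (-1)%R) conjgM -conjMg.
have -> : expgz y (-1)%R = y^-1 by [].
rewrite (conjgE b y^-1) invgK !mulgA; apply/conjg_commute/expgz_commute.
by rewrite /commute mulgVK !mulgA yb mulgK.
Qed.

Section FromTypeB.
Variables (G : groupType) (r : nat) (a : nat -> G).
Hypothesis hr : (2 <= r)%N.
Hypothesis aB : type_B_rel r a.

Definition type_B_map (x : cr_gen r) : G :=
  match x with
  | CRz => a 1
  | CRt i => a 2 ^ expgz (a 1) i
  | CRs j => a (val j)
  end.

Lemma type_B_map_rel u v : cr_rel 1 u v ->
  weval type_B_map (posw u) = weval type_B_map (posw v).
Proof.
case: aB => a_far a_braid a_four; have {}a_four := a_four hr.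
(* Powers of [a 1] fix [a j] for j >= 3 under conjugation, so each relation of t_i with s_j is a
   conjugate of the one with t_0. *)
have fix1 (j : s_index r) (i : int) : a (val j) ^ expgz (a 1%N) i = a (val j).
  apply/conjg_commute/expgz_commute/commute_sym/a_far => //.
  by have /= := valP j; lia.
case=> {u v} [u v|i|j]; last 2 first.
- rewrite /= !mulg1; have -> : (i - 1%:Z = i + -1)%R by lia.
  rewrite !(expgzD _ i) conjgM -(conjgCV (a 1%N)) //.

- rewrite /= !mulg1; apply: a_far => //.
  by have /= := valP j; lia.
case=> {u v} [i j ij|i j ij|i j|j i j3|j i j4]; rewrite /= !mulg1.
- have /= := valP i; have /= := valP j; move=> /= hj hi.
  case/orP: ij => /= ij; first by apply: a_far; lia.
  by apply/commute_sym/a_far; lia.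
- have /= := valP i; have /= := valP j.
  move=> /= hj hi; move: ij hj => /= -> hj.
  by rewrite !mulgA; apply: a_braid; lia.
- by rewrite !conj_expgz_prod.
- rewrite -(fix1 j i) -!conjMg; congr (_ ^ _).
  have /= := valP j; move: j3 => /= -> hj.
  by rewrite !mulgA a_braid //; lia.
- rewrite -(fix1 j i) -!conjMg; congr (_ ^ _).
  apply/commute_sym/a_far => //.
  by have /= := valP j; move: j4 => /= ; lia.
Qed.

End FromTypeB.

Section TypeBMap.
Variable r : nat.
Hypothesis hr : (2 <= r)%N.

Definition pure_gen (j : nat) : pure1 r :=
  insubd (1 : pure1 r) (pure_sigma r.+1 j).

Lemma pure_genE j : (1 <= j <= r)%N -> val (pure_gen j) = pure_sigma r.+1 j.
Proof.
move=> jr; rewrite /pure_gen insubdK // /pure_sigma.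
case: eqP => [_|/eqP j1]; first by apply: sigma1_pure1; lia.
by apply: sigma_pure1; lia.
Qed.

Lemma pure_gen_rel : type_B_rel r pure_gen.
Proof.
split=> [i j i1 ij|i ir|_]; try (rewrite /commute); apply: val_inj;
  rewrite !valM !pure_genE ?/pure_sigma; try lia.
- have -> : (j == 1%N) = false by lia.
  have [_|_] := eqVneq i 1%N.
    by apply/commute_sym/commuteX/commute_sym/sigma_far; lia.
  by apply: sigma_far; lia.
- have -> : (i == 1%N) = false by lia.
  by rewrite /=; case: i ir => // i ir /=; apply: sigma_braid; lia.
- rewrite /= expg2; have h := sigma_braid (n := r.+1) (i := 1%N) isT hr.
  rewrite !mulgA.
  (* The braid relation after a prefix x, to rewrite inside left-associated products. *)
  have h' x : x * sigma r.+1 1 * sigma r.+1 2 * sigma r.+1 1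
      = x * sigma r.+1 2 * sigma r.+1 1 * sigma r.+1 2.
    by rewrite -!mulgA; congr (_ * _); rewrite !mulgA.
  by rewrite [in LHS]h' [in RHS]h' -[in RHS]h [in RHS]h'.
Qed.

End TypeBMap.

(** * Relations among z, t_i and s_j as identities in groups *)

(** Stated for elements of any group, so that one cocycle on the integers serves both B(oo,oo,r) and
    B(de,e,r). *)
Definition ts_holds (r : nat) (G : groupType)
    (t : int -> G) (s : s_index r -> G) :=
  forall u v, ts_rel t s u v -> foldr *%g 1 u = foldr *%g 1 v.

Lemma pgen_ts (r : nat) (A : choiceType) (R : seq A -> seq A -> Prop)
    (t : int -> A) (s : s_index r -> A) :
  (forall u v, ts_rel t s u v -> R u v) ->
  ts_holds (fun i => pgen R (t i)) (fun j => pgen R (s j)).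
Proof.
move=> tsR _ _ [i j ij|i j ij|i j|j i j3|j i j4].
- exact/(@pgen_rel _ _ [:: s i; s j] [:: s j; s i])/tsR/ts_rel_ss.
- exact/(@pgen_rel _ _ [:: s i; s j; s i] [:: s j; s i; s j])/tsR/ts_rel_sss.
- exact/(@pgen_rel _ _ [:: t i; t _] [:: t j; t _])/tsR/ts_rel_tt.
- exact/(@pgen_rel _ _ [:: s j; t i; s j] [:: t i; s j; t i])/tsR/ts_rel_sts.
- exact/(@pgen_rel _ _ [:: s j; t i] [:: t i; s j])/tsR/ts_rel_st.
Qed.

Lemma cr_ts (de e r : nat) : ts_holds (@cr_t de e r) (@cr_s de e r).
Proof. exact/pgen_ts/cr_rel_ts. Qed.

Lemma cr_inf_ts (r : nat) :
  ts_holds (fun i => pgen (ts_rel CRIt (@CRIs r)) (CRIt i))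
    (fun j => pgen (ts_rel CRIt (@CRIs r)) (CRIs j)).
Proof. exact/pgen_ts. Qed.

Lemma cr_zt (de e r : nat) (i : int) :
  cr_t de e r i ^ cr_z de e r = cr_t de e r (i + e%:Z)%R.
Proof.
apply: (mulgI (cr_z de e r)); rewrite -conjgC.
have := @pgen_rel _ _ _ _ (@cr_rel_zt e r (i + e%:Z)%R).
by rewrite /= !mulg1 addrK.
Qed.

Lemma cr_zs (de e r : nat) (j : s_index r) :
  commute (cr_z de e r) (cr_s de e j).
Proof.
by have := @pgen_rel _ _ _ _ (@cr_rel_zs e r j); rewrite /= !mulg1.
Qed.

Lemma cr_tJ (de e r : nat) (i k : int) :
  cr_t de e r i ^ expgz (cr_z de e r) k = cr_t de e r (i + k * e%:Z)%R.
Proof.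
elim/int_ind_step: k => [|k IH|k IH].
- by rewrite mul0r addr0 /= conjg1.
- by rewrite expgzS conjgM IH cr_zt; congr cr_t; lia.
- rewrite expgzB1 conjgM IH; apply: (canLR (conjgK _)).
  by rewrite cr_zt; congr cr_t; lia.
Qed.

(** * The isomorphism of B(d,1,r) with B_{r+1,1} *)

Section TypeBIso.
Variables d r : nat.
Hypothesis hr : (2 <= r)%N.
Local Notation G := (cr_braid d 1 r).

Definition cr_a (j : nat) : G :=
  if j == 1%N then cr_z d 1 r
  else if j == 2 then cr_t d 1 r 0%R
  else if insub j is Some i then cr_s d 1 i else 1.

Lemma cr_a_s (j : s_index r) : cr_a (val j) = cr_s d 1 j.
Proof.
rewrite /cr_a valK; have /= := valP j => hj.
by do 2![case: eqP => [h|_]; first lia].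
Qed.

Lemma cr_a_ge3 j : (3 <= j <= r)%N ->
  exists2 i : s_index r, val i = j & cr_a j = cr_s d 1 i.
Proof. by move=> hj; exists (Sub j hj); rewrite ?SubK // -cr_a_s SubK. Qed.

Lemma cr_type_B : type_B_rel r cr_a.
Proof.
have ts := @cr_ts d 1 r.
split=> [i j i1 ij|i ir|_].
- have [|j' j'E ->] := @cr_a_ge3 j; first lia.
  have [->|i_neq1] := eqVneq i 1%N; first exact: cr_zs.
  have [->|i_neq2] := eqVneq i 2.
    have := ts _ _ (@ts_rel_st _ _ _ _ j' 0%R _).
    rewrite /= !mulg1 => h; apply/commute_sym/h; move: j'E => /= ->; lia.
  have [|i' i'E ->] := @cr_a_ge3 i; first lia.
  have := ts _ _ (@ts_rel_ss _ _ _ _ i' j' _).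
  by rewrite /= !mulg1; apply; rewrite [val i']i'E [val j']j'E; lia.
- have [|j' j'E ->] := @cr_a_ge3 i.+1; first lia.
  have [i2|i_neq2] := eqVneq i 2.
    have := ts _ _ (@ts_rel_sts _ _ _ _ j' 0%R _).
    rewrite /= !mulg1 !mulgA i2 => -> //; last by rewrite j'E i2.
  have [|i' i'E ->] := @cr_a_ge3 i; first lia.
  have := ts _ _ (@ts_rel_sss _ _ _ _ i' j' _).
  by rewrite /= !mulg1 !mulgA; apply; rewrite [val i']i'E [val j']j'E.
(* With every z moved to the right, the four-term relation is t_0 t_(-1) = t_(-1) t_(-2) times
   z^2. *)
- have zt i : cr_z d 1 r * cr_t d 1 r i = cr_t d 1 r (i - 1)%R * cr_z d 1 r.
    by rewrite -(subrK 1%R i) -cr_zt -conjgC addrK.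
  have := ts _ _ (@ts_rel_tt _ _ _ _ 0%R (-1)%R).
  rewrite /= !mulg1 => tt.
  have e : cr_z d 1 r * cr_t d 1 r 0%R = cr_t d 1 r (-1)%R * cr_z d 1 r.
    by rewrite zt; congr (cr_t _ _ _ _ * _).
  rewrite /cr_a /= -[_ * cr_z d 1 r * cr_t d 1 r _ in RHS]mulgA e.
  rewrite -[LHS]mulgA !e -[LHS]mulgA [cr_z d 1 r * (_ * _)]mulgA zt.
  by rewrite -[X in _ * X = _]mulgA [LHS]mulgA -tt -!mulgA.
Qed.

(** Hence the elements [cr_a j] generate B(d,1,r). *)
Lemma cr_map_a (x : cr_gen r) : type_B_map cr_a x = pgen (@cr_rel 1 r) x.
Proof.
case: x => [|i|j] //=; last exact: cr_a_s.
by rewrite cr_tJ; congr cr_t; lia.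
Qed.

Definition cr_to_pure1 : G -> pure1 r := pres_lift (type_B_map (@pure_gen r)).

Lemma cr_to_pure1M : {morph cr_to_pure1 : x y / x * y}.
Proof. exact/pres_liftM/type_B_map_rel/pure_gen_rel. Qed.

Lemma cr_to_pure1_gen (x : cr_gen r) :
  cr_to_pure1 (pgen (@cr_rel 1 r) x) = type_B_map (@pure_gen r) x.
Proof. exact/pres_lift_gen/type_B_map_rel/pure_gen_rel. Qed.

Lemma cr_to_pure1_a j : (1 <= j <= r)%N -> cr_to_pure1 (cr_a j) = pure_gen r j.
Proof.
move=> jr; have [->|j1] := eqVneq j 1%N; first exact: cr_to_pure1_gen.
have [->|j2] := eqVneq j 2; first by rewrite cr_to_pure1_gen /= conjg1.
have [|j' <- ->] := @cr_a_ge3 j; first lia.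
exact: cr_to_pure1_gen.
Qed.

Let F (x : G) : braid r.+1 := val (cr_to_pure1 x).

Let FM : {morph F : x y / x * y}.
Proof. by move=> x y; rewrite /F cr_to_pure1M valM. Qed.

Let F_a j : (1 <= j <= r)%N -> F (cr_a j) = pure_sigma r.+1 j.
Proof. by move=> jr; rewrite /F cr_to_pure1_a // pure_genE. Qed.

Let act : braid r.+1 -> 'I_r.+1 -> 'I_r.+1 :=
  pres_act (@adj_tperm r) (@adj_tperm r).
Let coc : braid r.+1 -> 'I_r.+1 -> G :=
  pres_coc (@adj_tperm r) (@adj_tperm r) (braid_coc cr_a).

Let adjK (i : artin_gen r.+1) : cancel (adj_tperm i) (adj_tperm i).
Proof. by move=> p; rewrite -{1}adj_tpermV permK. Qed.

Let act_rel := @braid_act_rel r.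
Let coc_rel := braid_coc_rel cr_type_B.

Let actM x y p : act (x * y) p = act y (act x p).
Proof. exact: (pres_actM adjK adjK act_rel). Qed.
Let act1 p : act 1 p = p.
Proof. exact: (pres_act1 adjK adjK act_rel). Qed.
Let actVK x : cancel (act x^-1) (act x).
Proof. exact: (pres_actVK adjK adjK act_rel). Qed.
Let act_gen i p : act (pgen (@artin_rel r.+1) i) p = adj_tperm i p.
Proof. exact: (pres_act_gen adjK adjK act_rel). Qed.
Let cocM x y p : coc (x * y) p = coc x p * coc y (act x p).
Proof. exact: (pres_cocM adjK adjK act_rel coc_rel). Qed.
Let coc1 p : coc 1 p = 1.
Proof. exact: (pres_coc1 adjK adjK act_rel coc_rel). Qed.
Let cocV x p : coc x^-1 (act x p) = (coc x p)^-1.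
Proof. exact: (pres_cocV adjK adjK act_rel coc_rel). Qed.
Let coc_gen i p : coc (pgen (@artin_rel r.+1) i) p = braid_coc cr_a i p.
Proof. exact: (pres_coc_gen adjK adjK act_rel coc_rel). Qed.

Lemma act_braid_perm (g : braid r.+1) (p : 'I_r.+1) : act g p = braid_perm g p.
Proof. exact: word_act_perm. Qed.

(** The cocycle identity reduces this to generators. There the four cases of [schreier] are
    [coset_rep_far], the recursion of [coset_rep], [coset_rep_band] and [coset_rep_near]. *)
Lemma coset_rep_coc (g : braid r.+1) (p : 'I_r.+1) :
  coset_rep r.+1 p * g
  = F (coc g p) * coset_rep r.+1 (act g p).
Proof.
elim/presented_ind: g p => [p|x y IHx IHy p|x IH p|i p].
- by rewrite act1 coc1 (morph_mul1 FM) mulg1 mul1g.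
- rewrite actM cocM FM -mulgA -IHy mulgA IHx.
  by rewrite mulgA.
- rewrite -{1 2}[p](actVK x) cocV (morph_mulV FM).
  apply: (mulIg x); rewrite mulgVK -mulgA.
  by apply: (mulgI (F (coc x (act x^-1 p)))); rewrite mulVKg -IH.
rewrite act_gen coc_gen -sigma_gen adj_tpermE /braid_coc.
have /= := valP i; set j := val i => ji; have pr : (p <= r)%N by rewrite -ltnS.
rewrite /schreier.
have [pj|pj] := ltnP p j.-1; decide_ifs.
  rewrite coset_rep_far; last lia.
  rewrite F_a /pure_sigma; last lia.
  by decide_ifs.
have [pj'|pj'] := eqVneq (p : nat) j.-1; decide_ifs.
  rewrite (morph_mul1 FM) mul1g pj'; case: j ji {pj pj'} => //.
have [pj2|pj2] := eqVneq (p : nat) j; decide_ifs.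
  rewrite pj2 coset_rep_band; last lia.
  by rewrite (morph_band FM F_a); last lia.
rewrite coset_rep_near; try lia.
rewrite F_a /pure_sigma; last lia.
by decide_ifs.
Qed.

(** The image of f fixes position 0, so c(f(x), 0) is multiplicative in x and only the elements
    [cr_a j] need checking. *)
Lemma cr_to_pure1K : cancel cr_to_pure1 (fun g => coc (val g) ord0).
Proof.
have act0 x : act (F x) ord0 = ord0.
  by rewrite act_braid_perm; apply/eqP/(valP (cr_to_pure1 x)).
pose P x := coc (F x) ord0 = x.
have P1 : P 1 by rewrite /P (morph_mul1 FM) coc1.
have PM x y : P x -> P y -> P (x * y).
  by rewrite /P FM cocM act0 => -> ->.
have PV x : P x -> P x^-1.
  by rewrite /P (morph_mulV FM) -{2}[ord0](act0 x) cocV => ->.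
have coc_sigma i (p : 'I_r.+1) : (1 <= i <= r)%N ->
    coc (sigma r.+1 i) p = schreier cr_a i p.
  move=> ir; rewrite /sigma; case: insubP => [u _ ui|]; last lia.
  by rewrite coc_gen /braid_coc ui.
have Pa j : (1 <= j <= r)%N -> P (cr_a j).
  (* The two letters of sigma_1^2 take 0 to 1 and back, with values 1 and [band cr_a 1]; for j >= 2,
     sigma_j fixes 0 with value [cr_a j]. *)
  move=> jr; rewrite /P F_a // /pure_sigma; case: eqP => [->|j1].
    rewrite expg2 cocM !coc_sigma; try lia.
    rewrite act_braid_perm /sigma; case: insubP => [u _ u1|]; last lia.
    by rewrite braid_perm_gen adj_tpermE u1 /schreier /= mul1g.
  by rewrite coc_sigma // /schreier (_ : nat_of_ord ord0 = 0%N) //; decide_ifs.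
move=> x; apply: (presented_ind P1 PM PV) => {x} x.
rewrite -cr_map_a; case: x => [|i|j] /=.
- by apply: Pa; lia.
- have Pz : P (expgz (cr_a 1%N) i) by apply: expgz_closed => //; apply: Pa; lia.
  by rewrite conjgE; apply: (PM); [apply: PV | apply: PM => //; apply: Pa].
- by apply: Pa; have /= := valP j; lia.
Qed.

Lemma pure1_cocK : cancel (fun g => coc (val g) ord0) cr_to_pure1.
Proof.
move=> g; apply: val_inj; have := coset_rep_coc (val g) ord0.
rewrite act_braid_perm (_ : braid_perm _ _ = ord0); last exact/eqP/(valP g).
by rewrite mul1g mulg1.
Qed.

Lemma cr_to_pure1_bij : bijective cr_to_pure1.
Proof. exact: Bijective cr_to_pure1K pure1_cocK. Qed.

End TypeBIso.

(** * The action of B(d,1,r) on the integers and its cocycle *)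

Definition z_shift (r : nat) (x : cr_gen r) (k : int) : int :=
  if x is CRz then (k + 1)%R else k.

Definition z_unshift (r : nat) (x : cr_gen r) (k : int) : int :=
  if x is CRz then (k - 1)%R else k.

Lemma z_shiftK (r : nat) (x : cr_gen r) : cancel (z_shift x) (z_unshift x).
Proof. by case: x => [|i|j] k //=; rewrite addrK. Qed.

Lemma z_unshiftK (r : nat) (x : cr_gen r) : cancel (z_unshift x) (z_shift x).
Proof. by case: x => [|i|j] k //=; rewrite subrK. Qed.

Lemma z_shift_rel (r : nat) (u v : seq (cr_gen r)) (k : int) : cr_rel 1 u v ->
  word_act (@z_shift r) (@z_unshift r) (posw u) k
  = word_act (@z_shift r) (@z_unshift r) (posw v) k.
Proof. by case=> {u v} // u v; case. Qed.

Section ZCocycle.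
Variables (d r : nat) (H : groupType) (t : int -> H) (s : s_index r -> H).
Hypothesis ts : ts_holds t s.

(** With z^k as representative of k, the value at t_i is z^k t_i z^-k = t_(i-k). *)
Definition z_coc_gen (x : cr_gen r) (k : int) : H :=
  match x with
  | CRz => 1
  | CRt i => t (i - k)%R
  | CRs j => s j
  end.

Lemma z_coc_rel (u v : seq (cr_gen r)) (k : int) : cr_rel 1 u v ->
  word_coc (@z_shift r) (@z_unshift r) z_coc_gen (posw u) k
  = word_coc (@z_shift r) (@z_unshift r) z_coc_gen (posw v) k.
Proof.
case=> {u v} [u v|i|j] /=; last by rewrite mul1g !mulg1.
  case=> {u v} [i j ij|i j ij|i j|j i j3|j i j4] /=.
  - exact: ts (ts_rel_ss t s ij).
  - exact: ts (ts_rel_sss t s ij).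
  - rewrite ![(_ - 1 - k)%R]addrAC.
    exact: ts (ts_rel_tt t s (i - k)%R (j - k)%R).
  - exact: ts (ts_rel_sts t s (i - k)%R j3).
  - exact: ts (ts_rel_st t s (i - k)%R j4).
by rewrite mul1g !mulg1; congr t; lia.
Qed.

Definition z_act : cr_braid d 1 r -> int -> int :=
  pres_act (@z_shift r) (@z_unshift r).
Definition z_coc : cr_braid d 1 r -> int -> H :=
  pres_coc (@z_shift r) (@z_unshift r) z_coc_gen.

Let shK := @z_shiftK r.
Let unshK := @z_unshiftK r.
Let act_rel := @z_shift_rel r.
Let coc_rel := z_coc_rel.

Lemma z_actM x y k : z_act (x * y) k = z_act y (z_act x k).
Proof. exact: (pres_actM shK unshK act_rel). Qed.

Lemma z_act1 k : z_act 1 k = k.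
Proof. exact: (pres_act1 shK unshK act_rel). Qed.

Lemma z_actVK x : cancel (z_act x^-1) (z_act x).
Proof. exact: (pres_actVK shK unshK act_rel). Qed.

Lemma z_actK x : cancel (z_act x) (z_act x^-1).
Proof. exact: (pres_actK shK unshK act_rel). Qed.

Lemma z_act_gen x k : z_act (pgen (@cr_rel 1 r) x) k = z_shift x k.
Proof. exact: (pres_act_gen shK unshK act_rel). Qed.

Lemma z_cocM x y k : z_coc (x * y) k = z_coc x k * z_coc y (z_act x k).
Proof. exact: (pres_cocM shK unshK act_rel coc_rel). Qed.

Lemma z_coc1 k : z_coc 1 k = 1.
Proof. exact: (pres_coc1 shK unshK act_rel coc_rel). Qed.

Lemma z_cocV x k : z_coc x^-1 (z_act x k) = (z_coc x k)^-1.
Proof. exact: (pres_cocV shK unshK act_rel coc_rel). Qed.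

Lemma z_coc_pgen x k : z_coc (pgen (@cr_rel 1 r) x) k = z_coc_gen x k.
Proof. exact: (pres_coc_gen shK unshK act_rel coc_rel). Qed.

(** Only k = 0 is used later; general k carries the induction through products. *)
Lemma z_coc_decomp (F : H -> cr_braid d 1 r) :
  {morph F : x y / x * y} -> (forall i, F (t i) = cr_t d 1 r i) ->
  (forall j, F (s j) = cr_s d 1 j) ->
  forall x k, expgz (cr_z d 1 r) k * x
              = F (z_coc x k) * expgz (cr_z d 1 r) (z_act x k).
Proof.
move=> FM Ft Fs x; elim/presented_ind: x => [|x y IHx IHy|x IH|x] k.
- by rewrite z_act1 z_coc1 (morph_mul1 FM) mulg1 mul1g.
- by rewrite z_actM z_cocM FM -mulgA -IHy !mulgA IHx.
- rewrite -{1 2}[k](z_actVK x) z_cocV (morph_mulV FM).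
  apply: (mulgI (F (z_coc x (z_act x^-1 k)))).
  by rewrite mulVKg mulgA -IH mulgK.
rewrite z_act_gen z_coc_pgen; case: x => [|i|j] /=.
- by rewrite (morph_mul1 FM) mul1g expgzS.
- by rewrite Ft conjgCV -expgzN cr_tJ; congr (cr_t _ _ _ _ * _); lia.
- by rewrite Fs; apply/commute_sym/expgz_commute/commute_sym/cr_zs.
Qed.

Hypothesis hr : (2 <= r)%N.

Lemma z_act_wd x k : z_act x k = (k + wd (@cr_to_pure1 d r x))%R.
Proof.
pose f := @cr_to_pure1 d r.
have fM : {morph f : x y / x * y} := @cr_to_pure1M d r hr.
rewrite -[cr_to_pure1 x]/(f x).
elim/presented_ind: x k => [|x y IHx IHy|x IH|x] k.
- by rewrite z_act1 (morph_mul1 fM) wd1 addr0.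
- by rewrite z_actM fM wdM IHy IHx addrA.
- have wV : wd ((f x)^-1) = (- wd (f x))%R.
    by have := wdF 1 (f x); rewrite mul1g wd1 sub0r.
  by rewrite (morph_mulV fM) wV -{2}(z_actVK x k) IH addrK.
have w1 : wd (pure_gen r 1) = 1%R.
  by apply: wd_sigma1; rewrite ?pure_genE //; lia.
have w0 j : (2 <= j <= r)%N -> wd (pure_gen r j) = 0%R.
  move=> jr; apply: (wd_sigma jr).
  rewrite pure_genE /pure_sigma //; last lia.
  by decide_ifs.
rewrite z_act_gen /f cr_to_pure1_gen //; case: x => [|i|j] /=.
- by rewrite w1.
(* Comparing [wd] on both sides of [x * y ^ x = y * x] shows that conjugation preserves it. *)
- have := wdM (expgz (pure_gen r 1) i) (pure_gen r 2 ^ expgz (pure_gen r 1) i).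
  by rewrite -conjgC wdM w0 // add0r -[LHS]addr0 => /addrI <-; rewrite addr0.
- by rewrite w0 ?addr0 //; have /= := valP j; lia.
Qed.

End ZCocycle.

Lemma weval_ts (r : nat) (A : choiceType) (t : int -> A) (s : s_index r -> A)
    (G : groupType) (h : A -> G) :
  ts_holds (h \o t) (h \o s) ->
  forall u v, ts_rel t s u v -> weval h (posw u) = weval h (posw v).
Proof.
move=> hts _ _ [i j ij|i j ij|i j|j i j3|j i j4] /=.
- exact: hts (ts_rel_ss (h \o t) (h \o s) ij).
- exact: hts (ts_rel_sss (h \o t) (h \o s) ij).
- exact: hts (ts_rel_tt (h \o t) (h \o s) i j).
- exact: hts (ts_rel_sts (h \o t) (h \o s) i j3).
- exact: hts (ts_rel_st (h \o t) (h \o s) i j4).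
Qed.

(** * B(de,e,r) and winding numbers divisible by e *)

Section ModularSubgroup.
Variables d r e : nat.
Hypothesis hr : (2 <= r)%N.
Local Notation G := (cr_braid d 1 r).
Local Notation H := (cr_braid (d * e) e r).
Local Notation z := (cr_z d 1 r).
Local Notation zH := (cr_z (d * e) e r).
Local Notation act := (@z_act d r).
Local Notation coc := (@z_coc d r H (@cr_t (d * e) e r) (@cr_s (d * e) e r)).

Definition cr_incl_gen (x : cr_gen r) : G :=
  match x with
  | CRz => z ^+ e
  | CRt i => cr_t d 1 r i
  | CRs j => cr_s d 1 j
  end.

Lemma cr_incl_rel u v : cr_rel e u v ->
  weval cr_incl_gen (posw u) = weval cr_incl_gen (posw v).
Proof.
case=> {u v} [u v uv|i|j] /=.
- by apply: weval_ts uv; exact: (@cr_ts d 1 r).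
- rewrite !mulg1 -[z ^+ e]/(expgz z e%:Z) conjgCV -expgzN cr_tJ.
  by congr (cr_t _ _ _ _ * _); lia.
- by rewrite !mulg1; apply/commute_sym/commuteX/commute_sym/cr_zs.
Qed.

Definition cr_incl : H -> G := pres_lift cr_incl_gen.

Lemma cr_inclM : {morph cr_incl : x y / x * y}.
Proof. exact/pres_liftM/cr_incl_rel. Qed.

Lemma cr_incl_pgen x : cr_incl (pgen (@cr_rel e r) x) = cr_incl_gen x.
Proof. exact/pres_lift_gen/cr_incl_rel. Qed.

(* D is the exponent sum of z in u. *)
Lemma cr_incl_coc u : exists D : int, forall m : int,
  act (cr_incl u) (e%:Z * m)%R = (e%:Z * (m + D))%R /\
  coc (cr_incl u) (e%:Z * m)%R = expgz zH m * u * expgz zH (- (m + D))%R.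
Proof.
have ts := @cr_ts (d * e) e r.
elim/presented_ind: u => [|x y [D1 IH1] [D2 IH2]|x [D IH]|x].
- exists 0%R => m; rewrite (morph_mul1 cr_inclM) z_act1 (z_coc1 _ ts) addr0.
  by rewrite mulg1 -expgzD addrN.
- exists (D1 + D2)%R => m; rewrite cr_inclM z_actM (z_cocM ts).
  have [-> ->] := IH1 m; have [-> ->] := IH2 (m + D1)%R.
  by rewrite !addrA expgzN !mulgA mulgVK.
- exists (- D)%R => m; have [] := IH (m - D)%R; rewrite subrK => a1 c1.
  rewrite (morph_mulV cr_inclM) -a1 z_actK (z_cocV ts) c1; split=> //.
  by rewrite !invgM -!expgzN opprK mulgA.
rewrite cr_incl_pgen; case: x => [|i|j] /=.
- exists 1%R => m.
  (* The cocycle is 1 on z, so z^e merely shifts m by 1. *)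
  have zX n k : act (z ^+ n) k = (k + n%:Z)%R /\ coc (z ^+ n) k = 1.
    elim: n k => [|n IH] k; first by rewrite z_act1 (z_coc1 _ ts) addr0.
    rewrite expgS z_actM (z_cocM ts) z_act_gen (z_coc_pgen _ ts) mul1g /=.
    by have [-> ->] := IH (k + 1)%R; split=> //; lia.
  have [-> ->] := zX e (e%:Z * m)%R; split; first by rewrite mulrDr mulr1.
  by rewrite -expgzS expgzN mulgV.
- exists 0%R => m; rewrite addr0 z_act_gen (z_coc_pgen _ ts) /=; split=> //.
  (* Conjugation by z^m in B(de,e,r) turns t_i into t_(i - em), the value of the cocycle at the base
     point em. *)
  rewrite [expgz _ m * _]conjgCV -expgzN -mulgA -expgzD subrr mulg1 cr_tJ.
  by congr cr_t; lia.
- exists 0%R => m; rewrite addr0 z_act_gen (z_coc_pgen _ ts) /=; split=> //.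
  have zs : commute (cr_s (d * e) e j) (expgz zH m).
    exact/expgz_commute/commute_sym/cr_zs.
  by rewrite -zs -mulgA -expgzD subrr mulg1.
Qed.

Lemma cr_incl_wd u : wd_mod_pred e (@cr_to_pure1 d r (cr_incl u)).
Proof.
have [D /(_ 0%R)[+ _]] := cr_incl_coc u.
rewrite mulr0 z_act_wd // !add0r /wd_mod_pred => ->.
by rewrite modzMr mod0z.
Qed.

Definition cr_to_wd_mod (u : H) : pure1_wd_mod e r :=
  Sub (@cr_to_pure1 d r (cr_incl u)) (cr_incl_wd u).

Lemma cr_to_wd_modM : {morph cr_to_wd_mod : x y / x * y}.
Proof.
move=> x y; apply: val_inj.
by rewrite valM !SubK cr_inclM (@cr_to_pure1M d r hr).
Qed.

Lemma cr_to_wd_mod_bij : (1 <= e)%N -> bijective cr_to_wd_mod.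
Proof.
move=> he; have [g fK gK] := @cr_to_pure1_bij d r hr.
(* Read off from x = F(c(x, 0)) z^wd(f(x)): F sends the z of B(de,e,r) to z^e, whence the exponent
   wd / e. *)
exists (fun y => coc (g (val y)) 0%R * expgz zH (wd (val y) %/ e)%Z) => [u|y].
  have [D /(_ 0%R)[a c]] := cr_incl_coc u; rewrite SubK fK.
  rewrite mulr0 add0r in a c; rewrite z_act_wd // add0r in a.
  by rewrite a c mul1g mulKz ?expgzN ?mulgVK //; lia.
apply: val_inj; rewrite SubK cr_inclM -[RHS]gK; congr cr_to_pure1.
have := z_coc_decomp (@cr_ts (d * e) e r) cr_inclM
  (fun i => cr_incl_pgen (CRt i)) (fun j => cr_incl_pgen (CRs j))
  (g (val y)) 0%R.
rewrite mul1g z_act_wd // gK add0r => xE; rewrite [RHS]xE; congr (_ * _).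
rewrite (morph_expgz cr_inclM) cr_incl_pgen /= -expgz_expg mulrC divzK //.
by apply/dvdz_mod0P; have /eqP := valP y; rewrite mod0z.
Qed.


End ModularSubgroup.

(** * B(oo,oo,r) and winding number zero *)

Section KernelSubgroup.
Variables d r : nat.
Hypothesis hr : (2 <= r)%N.
Local Notation G := (cr_braid d 1 r).
Local Notation H := (cr_inf_braid r).
Local Notation H_rel := (ts_rel CRIt (@CRIs r)).
Local Notation tH := (fun i : int => pgen H_rel (CRIt i)).
Local Notation sH := (fun j : s_index r => pgen H_rel (CRIs j)).
Local Notation act := (@z_act d r).
Local Notation coc := (@z_coc d r H tH sH).

Definition cr_inf_incl_gen (x : cr_inf_gen r) : G :=
  match x with CRIt i => cr_t d 1 r i | CRIs j => cr_s d 1 j end.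

Lemma cr_inf_incl_rel u v : H_rel u v ->
  weval cr_inf_incl_gen (posw u) = weval cr_inf_incl_gen (posw v).
Proof. by apply: weval_ts; exact: (@cr_ts d 1 r). Qed.

Definition cr_inf_incl : H -> G := pres_lift cr_inf_incl_gen.

Lemma cr_inf_inclM : {morph cr_inf_incl : x y / x * y}.
Proof. exact/pres_liftM/cr_inf_incl_rel. Qed.

Lemma cr_inf_incl_pgen x : cr_inf_incl (pgen H_rel x) = cr_inf_incl_gen x.
Proof. exact/pres_lift_gen/cr_inf_incl_rel. Qed.

Lemma cr_inf_incl_act u k : act (cr_inf_incl u) k = k.
Proof.
elim/presented_ind: u k => [|x y IHx IHy|x IH|[i|j]] k.
- by rewrite (morph_mul1 cr_inf_inclM) z_act1.
- by rewrite cr_inf_inclM z_actM IHx IHy.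
- by rewrite (morph_mulV cr_inf_inclM) -{1}(IH k) z_actK.
- by rewrite cr_inf_incl_pgen z_act_gen.
- by rewrite cr_inf_incl_pgen z_act_gen.
Qed.

(** Without z the base point 0 never moves, and there the cocycle takes t_i and s_j to
    themselves. *)
Lemma cr_inf_incl_coc u : coc (cr_inf_incl u) 0%R = u.
Proof.
have ts := @cr_inf_ts r.
elim/presented_ind: u => [|x y IHx IHy|x IH|[i|j]].
- by rewrite (morph_mul1 cr_inf_inclM) (z_coc1 _ ts).
- by rewrite cr_inf_inclM (z_cocM ts) cr_inf_incl_act IHx IHy.
- rewrite (morph_mulV cr_inf_inclM) -{1}(cr_inf_incl_act x 0%R) (z_cocV ts).
  by rewrite IH.
- by rewrite cr_inf_incl_pgen (z_coc_pgen _ ts) /= subr0.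
- by rewrite cr_inf_incl_pgen (z_coc_pgen _ ts).
Qed.

Lemma cr_inf_incl_wd u : wd_zero_pred (@cr_to_pure1 d r (cr_inf_incl u)).
Proof.
have := cr_inf_incl_act u 0%R.
by rewrite z_act_wd // add0r /wd_zero_pred => ->.
Qed.

Definition cr_to_wd_zero (u : H) : pure1_wd_zero r :=
  Sub (@cr_to_pure1 d r (cr_inf_incl u)) (cr_inf_incl_wd u).

Lemma cr_to_wd_zeroM : {morph cr_to_wd_zero : x y / x * y}.
Proof.
move=> x y; apply: val_inj.
by rewrite valM !SubK cr_inf_inclM (@cr_to_pure1M d r hr).
Qed.

Lemma cr_to_wd_zero_bij : bijective cr_to_wd_zero.
Proof.
have [g fK gK] := @cr_to_pure1_bij d r hr.
exists (fun y => coc (g (val y)) 0%R) => [u|y].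
  by rewrite SubK fK cr_inf_incl_coc.
apply: val_inj; rewrite SubK -[RHS]gK; congr cr_to_pure1.
have := z_coc_decomp (@cr_inf_ts r) cr_inf_inclM
  (fun i => cr_inf_incl_pgen (CRIt i)) (fun j => cr_inf_incl_pgen (CRIs j))
  (g (val y)) 0%R.
(* As the winding number is 0, the decomposition has no z factor. *)
rewrite mul1g z_act_wd // gK add0r (eqP (valP y)) => xE.
by rewrite [RHS]xE mulg1.
Qed.

End KernelSubgroup.

(** * Assembly of the three isomorphisms *)

Theorem corollary4p3 (d r e : nat) (hd : (2 <= d)%N) (hr : (2 <= r)%N)
    (he : (1 <= e)%N) :
  [/\ (exists f : {multiplicative cr_braid d 1 r -> pure1 r},
         [/\ bijective f,
             val (f (cr_z d 1 r)) = sigma r.+1 1 ^+ 2,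
             (forall i : int, val (f (cr_t d 1 r i)) =
                expgz (sigma r.+1 1) (- (2 * i))%R * sigma r.+1 2
                * expgz (sigma r.+1 1) (2 * i)%R)
           & (forall j : s_index r, val (f (cr_s d 1 j)) = sigma r.+1 (val j))]),
      (exists f : {multiplicative cr_braid (d * e) e r -> pure1_wd_mod e r},
         bijective f)
    & (exists f : {multiplicative cr_inf_braid r -> pure1_wd_zero r},
         bijective f)].
Proof.
split.
- pose f : {multiplicative cr_braid d 1 r -> pure1 r} :=
    HB.pack (@cr_to_pure1 d r)
      (isMultiplicative.Build _ _ _ (@cr_to_pure1M d r hr)).
  have valXz (x : pure1 r) k : val (expgz x k) = expgz (val x) k.
    by apply: (morph_expgz (f := val)) => x' y'; exact: valM.
  have fE x : f (pgen (@cr_rel 1 r) x) = type_B_map (@pure_gen r) x.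
    exact: cr_to_pure1_gen.
  exists f; split; first exact: cr_to_pure1_bij.
  + by rewrite (fE CRz) /type_B_map pure_genE //; lia.
  + move=> i; rewrite (fE (CRt i)) /type_B_map conjgE !valM -expgzN !valXz.
    rewrite !pure_genE //; last lia.
    by rewrite -mulrN /pure_sigma /= mulgA -!(expgz_expg _ 2).
  + move=> j; have /andP[j3 jr] := valP j; rewrite (fE (CRs j)) /type_B_map.
    by rewrite pure_genE // /pure_sigma; [case: eqP j3 => // -> | lia].
- pose f : {multiplicative cr_braid (d * e) e r -> pure1_wd_mod e r} :=
    HB.pack (@cr_to_wd_mod d r e hr)
      (isMultiplicative.Build _ _ _ (@cr_to_wd_modM d r e hr)).
  by exists f; exact: cr_to_wd_mod_bij.
- pose f : {multiplicative cr_inf_braid r -> pure1_wd_zero r} :=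
    HB.pack (@cr_to_wd_zero d r hr)
      (isMultiplicative.Build _ _ _ (@cr_to_wd_zeroM d r hr)).
  by exists f; exact: cr_to_wd_zero_bij.
Qed.
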